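(* Let $d\ge 2$ be a fixed integer and let $D$ be a $d$-ary tree with at least two leaves. Then $$\max_{|T|=n,\ T\text{ strictly }d\text{-ary}}\gamma(D,T)=i_d(D)+\mathcal{O}(n^{-1/2}),$$ i.e. there is a constant $K=K(d,D)$ such that the two sides differ by at most $K n^{-1/2}$ for every integer $n\ge |D|$ with $n\equiv 1\bmod (d-1)$. In particular, $$\lim_{n\to\infty}\ \max_{|T|=n,\ T\text{ strictly }d\text{-ary}}\gamma(D,T)=i_d(D),$$ the limit being taken along $n\equiv 1\bmod (d-1)$.
   Context: All trees are finite and rooted, with unordered children; isomorphism means isomorphism of rooted trees. The single vertex is regarded as a tree whose only vertex is both root and leaf. For a rooted tree $T$, $|T|$ denotes its number of leaves. For an integer $d\ge 2$, a $d$-ary tree is a rooted tree in which every non-leaf vertex has between $2$ and $d$ children; it is strictly $d$-ary if every non-leaf vertex has exactly $d$ children. (An $n$-leaf strictly $d$-ary tree exists iff $n\ge 1$ and $n\equiv 1 \bmod (d-1)$.) For a nonempty set $S$ of leaves of $T$, the subtree of $T$ induced by $S$ is obtained by taking the minimal subtree of $T$ containing the leaves in $S$, rooting it at the most recent common ancestor of $S$, and suppressing (contracting) all non-root vertices of degree $2$. Let $c(D,T)$ be the number of sets of $|D|$ leaves of $T$ whose induced subtree is isomorphic to $D$, and for $|T|\ge |D|$ let $\gamma(D,T)=c(D,T)/\binom{|T|}{|D|}$. The inducibility of a $d$-ary tree $D$ in strictly $d$-ary trees is $$i_d(D)=\limsup_{n\to\infty}\ \max_{|T|=n,\ T\text{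 strictly }d\text{-ary}}\gamma(D,T),$$ where $n$ ranges over integers $n\equiv 1 \bmod (d-1)$. *)

(* Defs.v *)
From HB Require Import structures.
From mathcomp Require Import all_boot all_order all_algebra.
From mathcomp Require Import all_classical all_reals all_analysis.
Set Implicit Arguments.
Unset Strict Implicit.
Unset Printing Implicit Defensive.
Import Order.TTheory GRing.Theory Num.Theory numFieldNormedType.Exports.
Local Open Scope ring_scope.

(** The children are stored in a list; their order is
    discarded by [iso] below. [Node [::]] is the single vertex, both root and leaf. *)
Inductive rtree := Node of seq rtree.

Fixpoint rtree_encode (t : rtree) : GenTree.tree unit :=
  let: Node s := t in GenTree.Node 0 (map rtree_encode s).

Fixpoint rtree_decode (g : GenTree.tree unit) : rtree :=
  if g is GenTree.Node _ s then Node (map rtree_decode s) else Node [::].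

Lemma rtree_ind' (P : rtree -> Prop) :
  (forall s, (forall i, (i < size s)%N -> P (nth (Node [::]) s i)) ->
     P (Node s)) ->
  forall t, P t.
Proof.
move=> IH; fix F 1 => -[s]; apply: IH.
elim: s => [|t s IHs]; first by clear F.
by case=> [_|i]; [exact: F | exact: IHs].
Qed.

Lemma rtree_encodeK : cancel rtree_encode rtree_decode.
Proof.
elim/rtree_ind' => s IHs /=; congr Node; rewrite -map_comp.
apply: (@eq_from_nth _ (Node [::])) => [|i]; rewrite size_map // => lt_is.
by rewrite (nth_map (Node [::])) //= IHs.
Qed.

HB.instance Definition _ := Countable.copy rtree (can_type rtree_encodeK).

(** Isomorphism of rooted trees: equality up to reordering the children of
    each vertex. *)
Fixpoint iso (t u : rtree) : bool :=
  let: Node s := t in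
  let: Node r := u in
  has (fun r' => all2 iso s r') (permutations r).

Fixpoint dary (d : nat) (t : rtree) : bool :=
  let: Node s := t in
  (nilp s || (2 <= size s <= d)%N) && all (dary d) s.

Fixpoint strictly_dary (d : nat) (t : rtree) : bool :=
  let: Node s := t in
  (nilp s || (size s == d)) && all (strictly_dary d) s.

Definition mapi (A B : Type) (f : nat -> A -> B) : nat -> seq A -> seq B :=
  fix go i s := if s is x :: s' then f i x :: go i.+1 s' else [::].

(** A vertex is addressed by the sequence of child indices leading to it from
    the root; [leaves t] lists the addresses of the leaves. *)
Fixpoint leaves (t : rtree) : seq (seq nat) :=
  let: Node s := t in
  if nilp s then [:: [::]]
  else flatten (mapi (fun i u => map (cons i) (leaves u)) 0 s).

Definition leaf (t : rtree) : Type := seq_sub (leaves t).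
HB.instance Definition _ (t : rtree) := Finite.on (leaf t).

Definition nleaves (t : rtree) : nat := size (leaves t).

(** The union of the paths from the root to the leaves whose address
    satisfies [P]; [None] if there is no such leaf. *)
Fixpoint prune (P : pred (seq nat)) (t : rtree) : option rtree :=
  let: Node s := t in
  if nilp s then (if P [::] then Some t else None)
  else
    let s' := pmap id (mapi (fun i => prune (fun a => P (i :: a))) 0 s) in
    if nilp s' then None else Some (Node s').

(** In a pruned tree, the most recent common ancestor of the leaves is the
    first vertex on the way down from the root that does not have exactly one
    child. *)
Fixpoint mrca_subtree (t : rtree) : rtree :=
  if t is Node [:: u] then mrca_subtree u else t.

(** Non-root vertices of degree 2 are those with exactly one child. The root
    of [mrca_subtree t] never has exactly one child, so the root is kept when
    [suppress] is applied to such a tree. *)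
Fixpoint suppress (t : rtree) : rtree :=
  let: Node s := t in
  let s' := map suppress s in
  if s' is [:: u] then u else Node s'.

Definition induced (t : rtree) (S : {set leaf t}) : option rtree :=
  omap (fun u => suppress (mrca_subtree u))
       (prune (fun a => a \in [seq val x | x in S]) t).

Definition copies (D T : rtree) : nat :=
  #|[set S : {set leaf T} |
      (#|S| == nleaves D) && oapp (iso D) false (induced S)]%SET|.

Definition density (R : realType) (D T : rtree) : R :=
  (copies D T)%:R / 'C(nleaves T, nleaves D)%:R.

(** The supremum is a maximum, see [max_densityP] and [strict_tree_exists]. *)
Definition max_density (R : realType) (d : nat) (D : rtree) (n : nat) : R :=
  sup [set density R D T |
        T in [set T | strictly_dary d T /\ nleaves T = n]]%classic.

(** The limsup along [n = 1 %[mod d.-1]], enumerated as [n = k * d.-1 + 1];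
    the finitely many [n < nleaves D] are irrelevant. *)
Definition inducibility (R : realType) (d : nat) (D : rtree) : R :=
  limn_sup (fun k : nat => max_density R d D (k * d.-1 + 1)).

Lemma mapiE (A B : Type) (f : nat -> A -> B) (i : nat) (s : seq A) :
  mapi f i s = [seq f p.1 p.2 | p <- zip (iota i (size s)) s].
Proof. by elim: s i => //= x s IHs i; rewrite IHs. Qed.

Lemma nleaves_Node (s : seq rtree) :
  nleaves (Node s) = if nilp s then 1%N else sumn (map nleaves s).
Proof.
rewrite /nleaves /=; case: nilp => //.
rewrite size_flatten; congr sumn; elim: s 0%N => //= t s IHs i.
by rewrite IHs size_map.
Qed.

Lemma strict_tree_exists (d n : nat) : (2 <= d)%N -> (0 < n)%N ->
  n = 1 %[mod d.-1] -> exists T, strictly_dary d T /\ nleaves T = n.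
Proof.
move=> d2 n0 /eqP; rewrite eqn_mod_dvd // => /dvdnP[k nE].
have {nE}-> : n = (k * d.-1).+1 by rewrite -nE subn1 prednK.
elim: k {n n0} => [|k [T [sT nT]]]; first by exists (Node [::]).
exists (Node (T :: nseq d.-1 (Node [::]))); split.
  rewrite /= size_nseq prednK ?eqxx ?sT /=; last by case: d d2 {sT nT}.
  by rewrite all_nseq /= orbT.
rewrite nleaves_Node /= nT map_nseq sumn_nseq mul1n mulSn.
by rewrite addSn addnC.
Qed.

Lemma max_densityP (R : realType) (d : nat) (D : rtree) (n : nat) :
  (exists T, strictly_dary d T /\ nleaves T = n) ->
  (exists T, [/\ strictly_dary d T, nleaves T = n &
               density R D T = max_density R d D n]) /\
  (forall T, strictly_dary d T -> nleaves T = n ->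
     density R D T <= max_density R d D n).
Proof.
move=> [T0 [sT0 nT0]].
pose p c := `[< exists T, [/\ strictly_dary d T, nleaves T = n &
                           copies D T = c] >].
have exp : exists c, p c by exists (copies D T0); apply/asboolP; exists T0.
have ubp c : p c -> (c <= 2 ^ n)%N.
  move=> /asboolP[T [_ nT <-]]; apply: leq_trans (max_card _) _.
  have -> : #|{: {set leaf T}}| = (2 ^ #|{: leaf T}|)%N.
    by rewrite -cardsT -powersetT card_powerset cardsT.
  rewrite leq_pexp2l // -nT cardE -(size_map val).
  apply: uniq_leq_size; first
    by rewrite map_inj_uniq ?enum_uniq //; exact: val_inj.
  by move=> _ /mapP[x _ ->]; exact: valP.
case: (ex_maxnP exp ubp) => c /asboolP[T [sT nT cT]] cmax.
have ubT T' : strictly_dary d T' -> nleaves T' = n ->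
    density R D T' <= density R D T.
  move=> sT' nT'; rewrite /density nT nT' ler_wpM2r ?invr_ge0 ?ler0n //.
  by rewrite ler_nat cT; apply: cmax; apply/asboolP; exists T'.
have maxE : max_density R d D n = density R D T.
  apply/eqP; rewrite eq_le; apply/andP; split.
    apply: ge_sup => [|_ [T' [sT' nT'] <-]]; last exact: ubT.
    by exists (density R D T); exists T.
  apply: ub_le_sup; last by exists T.
  by exists (density R D T) => _ [T' [sT' nT'] <-]; exact: ubT.
by rewrite maxE; split=> //; exists T.
Qed.

(* Main.v *)
From HB Require Import structures.
Require Import Defs.
From mathcomp Require Import all_boot all_order all_algebra.
From mathcomp Require Import all_classical all_reals all_analysis.
From mathcomp Require Import zify lra.
Set Implicit Arguments.
Unset Strict Implicit.
Unset Printing Implicit Defensive.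
Import Order.TTheory GRing.Theory Num.Theory numFieldNormedType.Exports.

(** Let [k] be the number of leaves of [D].

    Sampling: averaging over the deleted leaf, some tree obtained from [T] by
    deleting one leaf (and suppressing) has density at least that of [T];
    iterating, a [d]-ary [T] contains an induced [d]-ary [S] with any prescribed
    number [s >= k] of leaves and with density at least that of [T].

    Blow-up: make a [d]-ary [S] with [s] leaves strictly [d]-ary by attaching at
    most [s * d] leaves, then replace each original leaf by a strictly [d]-ary
    tree with about [n / s] leaves.  Every copy of [D] in [S] yields one copy for
    each choice of a leaf in each of its [k] blobs, so the resulting [n]-leaf
    strictly [d]-ary tree has density at least that of [S] minus
    [O(1/s) + O(s/n)].

    Blowing up an optimal [n]-leaf tree bounds the maximum at [n] by the limsup
    plus [O(1/n)].  Conversely, sampling [s = floor (sqrt n)] leaves of a huge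
    optimal tree and blowing the sample up to [n] leaves loses
    [O(1/s + s/n) = O(1/sqrt n)]. *)

Lemma size_mapi (A B : Type) (f : nat -> A -> B) i s : size (mapi f i s) = size s.
Proof. by elim: s i => //= x s IH i; rewrite IH. Qed.

Lemma nth_mapi (A B : Type) (f : nat -> A -> B) x0 y0 i s j :
  (j < size s)%N -> nth y0 (mapi f i s) j = f (i + j)%N (nth x0 s j).
Proof.
elim: s i j => //= x s IH i [|j] lt_js; first by rewrite addn0.
by rewrite /= IH // addnS.
Qed.


Inductive ltree (Y : Type) := Lf of Y | Nd of seq (ltree Y).

HB.instance Definition _ (Y : Type) := gen_eqMixin (ltree Y).

Lemma ltree_ind' (Y : Type) (P : ltree Y -> Prop) :
  (forall x, P (Lf x)) -> (forall s, {in s, forall t, P t} -> P (Nd s)) ->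
  forall t, P t.
Proof.
move=> PLf PNd; fix F 1 => -[x|s]; first exact: PLf.
apply: PNd; elim: s => [|t s IHs] u; first by clear F; rewrite in_nil.
rewrite in_cons => /predU1P[->|]; [exact: F | clear F; exact: IHs].
Qed.

Implicit Types Y Z : Type.

Fixpoint unlabel Y (t : ltree Y) : rtree :=
  if t is Nd s then Node (map (@unlabel Y) s) else Node [::].

Fixpoint labels Y (t : ltree Y) : seq Y :=
  match t with Lf x => [:: x] | Nd s => flatten (map (@labels Y) s) end.

Fixpoint arity Y (l u : nat) (t : ltree Y) : bool :=
  if t is Nd s then (l <= size s <= u)%N && all (@arity Y l u) s else true.

(** [Nd [::]] represents the empty tree. *)
Definition empty Y (t : ltree Y) : bool := if t is Nd [::] then true else false.

Definition contract Y (s : seq (ltree Y)) : ltree Y :=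
  if s is [:: u] then u else Nd s.

Fixpoint restrict Y (P : pred Y) (t : ltree Y) : ltree Y :=
  match t with
  | Lf x => if P x then Lf x else Nd [::]
  | Nd s => contract (seq.filter (predC (@empty Y)) (map (restrict P) s))
  end.

Fixpoint bind Y Z (b : Y -> ltree Z) (t : ltree Y) : ltree Z :=
  match t with Lf x => b x | Nd s => Nd (map (bind b) s) end.

Definition relabel Y Z (f : Y -> Z) : ltree Y -> ltree Z := bind (fun x => Lf (f x)).

Lemma emptyP Y (t : ltree Y) : reflect (t = Nd [::]) (empty t).
Proof. by case: t => [x|[|u s]]; constructor. Qed.

Lemma labels_bind Y Z (b : Y -> ltree Z) t :
  labels (bind b t) = flatten [seq labels (b x) | x <- labels t].
Proof.
elim/ltree_ind': t => [x|s IHs] /=; first by rewrite cats0.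
rewrite -map_comp; elim: s IHs => //= t s IHs' IHs.
rewrite map_cat flatten_cat IHs ?mem_head // IHs' // => u us.
by apply: IHs; rewrite in_cons us orbT.
Qed.

Lemma labels_relabel Y Z (f : Y -> Z) t : labels (relabel f t) = map f (labels t).
Proof. by rewrite labels_bind; elim: (labels t) => //= x s ->. Qed.

Lemma relabel_comp X Y Z (g : Y -> Z) (f : X -> Y) t :
  relabel g (relabel f t) = relabel (g \o f) t.
Proof.
elim/ltree_ind': t => [x|s IHs] //=.
by congr Nd; rewrite -map_comp; apply/eq_in_map => t /IHs.
Qed.

Lemma relabel_id Y (t : ltree Y) : relabel id t = t.
Proof.
elim/ltree_ind': t => [x|s IHs] //=.
by congr Nd; rewrite -[RHS]map_id; apply/eq_in_map => t /IHs.
Qed.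

Lemma unlabel_relabel Y Z (f : Y -> Z) t : unlabel (relabel f t) = unlabel t.
Proof.
elim/ltree_ind': t => [x|s IHs] //=.
by congr Node; rewrite -map_comp; apply/eq_in_map => t /IHs.
Qed.

Lemma arity_bind Y Z (l u : nat) (b : Y -> ltree Z) t :
  (forall x, arity l u (b x)) -> arity l u t -> arity l u (bind b t).
Proof.
move=> bP; elim/ltree_ind': t => [x|s IHs] //= /andP[sz /allP sP].
rewrite size_map sz all_map; apply/allP => t ts /=.
by apply: IHs => //; apply: sP.
Qed.

Lemma restrict_bind (Y : eqType) Z (P : pred Z) (Q : pred Y) (b : Y -> ltree Z)
    (g : Y -> Z) t :
  {in labels t, forall x, restrict P (b x) = if Q x then Lf (g x) else Nd [::]} ->
  restrict P (bind b t) = relabel g (restrict Q t).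
Proof.
elim/ltree_ind': t => [x|s IHs] /= bP.
  by rewrite bP ?mem_head //; case: ifP.
have emptyE t : empty (relabel g t) = empty t by case: t => [|[]].
have -> : [seq restrict P i | i <- [seq bind b i | i <- s]] =
          map (relabel g) (map (restrict Q) s).
  rewrite -!map_comp; apply/eq_in_map => t ts /=; apply: IHs => // x xt.
  by apply: bP; apply/flattenP; exists (labels t) => //; apply: map_f.
rewrite filter_map (eq_filter (a2 := predC (@empty Y))) => [|t /=]; last by rewrite emptyE.
by case: (seq.filter _ _) => [|t []].
Qed.

Lemma restrict_relabel (Y : eqType) Z (P : pred Z) (f : Y -> Z) t :
  restrict P (relabel f t) = relabel f (restrict (P \o f) t).
Proof. by apply: restrict_bind => x _. Qed.

Lemma eq_in_restrict (Y : eqType) (P Q : pred Y) t :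
  {in labels t, P =1 Q} -> restrict P t = restrict Q t.
Proof.
move=> PQ; rewrite -[t in LHS]relabel_id -[RHS]relabel_id.
by apply: restrict_bind => x xt /=; rewrite PQ.
Qed.

Lemma restrict_restrict Y (P Q : pred Y) t :
  restrict P (restrict Q t) = restrict (predI P Q) t.
Proof.
elim/ltree_ind': t => [x|s IHs] /=; first by rewrite andbC; case: (Q x).
have -> : [seq restrict (predI P Q) t | t <- s] =
    map (restrict P) (map (restrict Q) s).
  by rewrite -map_comp; apply/eq_in_map => t /IHs.
set s1 := map (restrict Q) s.
have -> : [seq x <- [seq restrict P i | i <- s1] | predC (@empty Y) x] =
  [seq x <- [seq restrict P i | i <- [seq x <- s1 | predC (@empty Y) x]]
     | predC (@empty Y) x].
  elim: s1 => //= t s1 ->; case: (emptyP t) => [->|] //=.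
case: (seq.filter _ s1) => [|t [|t' s']] //=.
by case: (emptyP (restrict P t)) => [->|].
Qed.

Lemma labels_contract Y (s : seq (ltree Y)) :
  labels (contract s) = flatten (map (@labels Y) s).
Proof. by case: s => [|t []] //=; rewrite cats0. Qed.

Lemma labels_restrict Y (P : pred Y) t :
  labels (restrict P t) = seq.filter P (labels t).
Proof.
elim/ltree_ind': t => [x|s IHs] /=; first by case: (P x).
rewrite filter_flatten -map_comp.
have -> : [seq (seq.filter P \o @labels Y) t | t <- s] =
    map (@labels Y) (map (restrict P) s).
  by rewrite -map_comp; apply/eq_in_map => t /IHs.
rewrite labels_contract.
by elim: (map (restrict P) s) => //= t s' <-; case: (emptyP t) => [->|].
Qed.

Lemma arity_restrict Y (u : nat) (P : pred Y) t : arity 2 u t ->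
  empty (restrict P t) || arity 2 u (restrict P t).
Proof.
elim/ltree_ind': t => [x|s IHs] /=; first by case: (P x).
move=> /andP[/andP[_ su] /allP sP].
set s' := seq.filter _ _.
have s'P : all (arity 2 u) s'.
  apply/allP => t; rewrite mem_filter => /andP[/= tN /mapP[v vs tE]].
  by have := IHs _ vs (sP _ vs); rewrite -tE (negbTE tN).
have : (size s' <= u)%N.
  by rewrite size_filter; apply: leq_trans (count_size _ _) _; rewrite size_map.
move: s' s'P => [|t [|t' s']] //=; first by rewrite andbT => -> _; rewrite orbT.
by move=> -> ->.
Qed.

Lemma arity_labels Y (u : nat) (t : ltree Y) : arity 2 u t -> (0 < size (labels t))%N.
Proof.
elim/ltree_ind': t => [x|[|t s] IHs] //= /andP[_ /andP[tP _]].
by rewrite size_cat addn_gt0 IHs ?mem_head.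
Qed.

Lemma arity_labels1 Y (u : nat) (t : ltree Y) x :
  arity 2 u t -> labels t = [:: x] -> t = Lf x.
Proof.
case: t => [y _ [->]|[|t [|t' s]]] //= /andP[_] /and3P[tP t'P _] E.
move: (arity_labels tP) (arity_labels t'P) (congr1 size E).
rewrite !size_cat /=; lia.
Qed.

Fixpoint address (T : rtree) : ltree (seq nat) :=
  let: Node s := T in
  if nilp s then Lf [::]
  else Nd (mapi (fun i u => relabel (cons i) (address u)) 0 s).

Lemma addressE s : ~~ nilp s ->
  address (Node s) = Nd (mapi (fun i u => relabel (cons i) (address u)) 0 s).
Proof. by case: s. Qed.

Lemma labels_address T : labels (address T) = leaves T.
Proof.
elim/rtree_ind': T => s IHs; case: (boolP (nilp s)) => [/nilP->//|sN].
rewrite addressE // [leaves _]/= (negbTE sN) [LHS]/=.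
congr flatten; apply: (@eq_from_nth _ [::]) => [|i].
  by rewrite size_map !size_mapi.
rewrite size_map size_mapi => lt_is.
rewrite (nth_map (Lf [::])) ?size_mapi // !(nth_mapi _ (Node [::])) //.
by rewrite labels_relabel IHs.
Qed.

Lemma unlabel_address T : unlabel (address T) = T.
Proof.
elim/rtree_ind': T => s IHs; case: (boolP (nilp s)) => [/nilP->//|sN].
rewrite addressE // [LHS]/=.
congr Node; apply: (@eq_from_nth _ (Node [::])) => [|i].
  by rewrite size_map !size_mapi.
rewrite size_map size_mapi => lt_is.
rewrite (nth_map (Lf [::])) ?size_mapi // !(nth_mapi _ (Node [::])) //.
by rewrite unlabel_relabel IHs.
Qed.

Lemma uniq_leaves T : uniq (leaves T).
Proof.
elim/rtree_ind': T => s IHs /=; case: ifP => // _.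
elim: s 0 IHs => //= T s IHs i H.
rewrite cat_uniq map_inj_uniq => [|a b []//].
rewrite (H 0) // IHs => [|j]; last exact: (H j.+1).
rewrite andbT; apply/hasPn => a /flattenP[r rs ar].
apply/mapP => -[b _ E]; rewrite {}E in ar.
have /(nthP [::])[j] := rs; rewrite size_mapi => lt_js.
rewrite (nth_mapi _ (Node [::])) // => rE.
by move: ar; rewrite -rE => /mapP[c _ [/eqP]]; rewrite ltn_eqF // addSn ltnS leq_addr.
Qed.

Lemma size_labels Y (u : nat) (t : ltree Y) :
  arity 2 u t -> nleaves (unlabel t) = size (labels t).
Proof.
elim/ltree_ind': t => [x|s IHs] // /andP[/andP[s2 _] /allP sP].
rewrite [unlabel _]/= nleaves_Node; case: nilP => [|_].
  by case: s s2 {IHs sP}.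
rewrite [labels _]/= size_flatten; congr sumn.
rewrite -[RHS]map_comp -[LHS]map_comp.
by apply/eq_in_map => t ts; apply: IHs => //; apply: sP.
Qed.

Lemma dary_unlabel Y (d : nat) (t : ltree Y) : arity 2 d t -> dary d (unlabel t).
Proof.
elim/ltree_ind': t => [x|s IHs] //= /andP[sz /allP sP].
rewrite size_map sz orbT all_map; apply/allP => t ts; apply: IHs => //.
exact: sP.
Qed.

Lemma strictly_dary_unlabel Y (d : nat) (t : ltree Y) :
  arity d d t -> strictly_dary d (unlabel t).
Proof.
elim/ltree_ind': t => [x|s IHs] //= /andP[/andP[ds sd] /allP sP].
rewrite size_map eqn_leq sd ds orbT all_map; apply/allP => t ts; apply: IHs => //.
exact: sP.
Qed.

Lemma arity_mapi_address l u s : all (arity l u) (map address s) ->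
  all (arity l u) (mapi (fun i T => relabel (cons i) (address T)) 0 s).
Proof.
elim: s 0 => //= T s IHs i /andP[TP sP].
by rewrite IHs // arity_bind.
Qed.

Lemma arity_address d T : dary d T -> arity 2 d (address T).
Proof.
elim/rtree_ind': T => s IHs; case: (boolP (nilp s)) => [/nilP->//|sN].
rewrite addressE //= (negbTE sN) size_mapi /= => /andP[-> sP].
apply: arity_mapi_address; apply/(all_nthP (Lf [::])) => i; rewrite size_map => lt_is.
by rewrite (nth_map (Node [::])) // IHs //; exact: (allP sP) _ (mem_nth (Node [::]) lt_is).
Qed.

Lemma arity_address_strict d T : strictly_dary d T -> arity d d (address T).
Proof.
elim/rtree_ind': T => s IHs; case: (boolP (nilp s)) => [/nilP->//|sN].
rewrite addressE //= (negbTE sN) size_mapi /= => /andP[/eqP-> sP].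
rewrite leqnn; apply: arity_mapi_address.
apply/(all_nthP (Lf [::])) => i; rewrite size_map => lt_is.
by rewrite (nth_map (Node [::])) // IHs //; exact: (allP sP) _ (mem_nth (Node [::]) lt_is).
Qed.

Lemma arity_sub Y (l u l' u' : nat) (t : ltree Y) : (l' <= l)%N -> (u <= u')%N ->
  arity l u t -> arity l' u' t.
Proof.
move=> ll uu; elim/ltree_ind': t => [x|s IHs] //= /andP[/andP[ls su] /allP sP].
rewrite (leq_trans ll ls) (leq_trans su uu); apply/allP => t ts.
by apply: IHs => //; apply: sP.
Qed.

Lemma address_unlabel Y (u : nat) (t : ltree Y) : arity 2 u t ->
  exists f, t = relabel f (address (unlabel t)).
Proof.
elim/ltree_ind': t => [x|s IHs]; first by exists (fun=> x).
move=> /andP[/andP[s2 _] /allP sP].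
have [g gP] : exists g : nat -> seq nat -> Y, forall i, (i < size s)%N ->
    nth (Nd [::]) s i = relabel (g i) (address (unlabel (nth (Nd [::]) s i))).
  have y0 : Y.
    case: s s2 sP {IHs} => // t s _ /(_ t (mem_head _ _)).
    by move/arity_labels; case: (labels t).
  have /choice[g gP] : forall i : nat, exists f, (i < size s)%N ->
    nth (Nd [::]) s i = relabel f (address (unlabel (nth (Nd [::]) s i))).
    move=> i; have [lt_is|_] := ltnP; last by exists (fun=> y0).
    have ts := mem_nth (Nd [::]) lt_is.
    by have [f fE] := IHs _ ts (sP _ ts); exists f.
  by exists g.
exists (fun a => g (head 0 a) (behead a)).
rewrite [unlabel _]/= addressE; last by case: s s2 {IHs sP gP}.
congr Nd; apply: (@eq_from_nth _ (Nd [::])) => [|i lt_is].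
  by rewrite size_map size_mapi size_map.
rewrite (nth_map (Lf [::])) ?size_mapi ?size_map // (nth_mapi _ (Node [::])) ?size_map //.
by rewrite (nth_map (Nd [::])) // {1}gP // -[RHS]/(relabel _ (relabel (cons i) _)) relabel_comp.
Qed.

Lemma restrict_mapi_address (P : pred (seq nat)) i s :
  map (restrict P) (mapi (fun i T => relabel (cons i) (address T)) i s) =
  mapi (fun i T => relabel (cons i) (restrict (fun a => P (i :: a)) (address T))) i s.
Proof. by elim: s i => //= T s IHs i; rewrite IHs restrict_relabel. Qed.

Lemma suppress_mrca T : suppress (mrca_subtree T) = suppress T.
Proof.
elim/rtree_ind': T => -[|T [|T' s]] //= /(_ 0 isT) /= ->.
by case: (suppress T).
Qed.

Lemma suppress_prune (P : pred (seq nat)) T :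
  omap suppress (prune P T) =
  let t := restrict P (address T) in if empty t then None else Some (unlabel t).
Proof.
elim/rtree_ind': T P => s IHs P; case: (boolP (nilp s)) => [/nilP->/=|sN].
  by case: (P [::]).
rewrite addressE // [restrict _ _]/= restrict_mapi_address [prune _ _]/= (negbTE sN).
set r := mapi _ 0 s; set q := mapi _ 0 s.
have rq : map (omap suppress) r = [seq if empty t then None else Some (unlabel t) | t <- q].
  apply: (@eq_from_nth _ None) => [|i]; first by rewrite !size_map !size_mapi.
  rewrite size_map size_mapi => lt_is.
  rewrite (nth_map None) ?size_mapi // (nth_map (Nd [::])) ?size_mapi //.
  rewrite !(nth_mapi _ (Node [::])) // IHs //= unlabel_relabel.
  by case: (restrict _ _) => [|[]].
have rqE : map suppress (pmap id r) = map (@unlabel _) [seq t <- q | ~~ empty t].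
  elim: r q rq {IHs} => [|o r IHr] [|t q] //= [ot /IHr E].
  by case: o ot => [T|] /=; case: (empty t) => //= -[<-]; rewrite -E.
have : all (predC (@empty _)) [seq t <- q | ~~ empty t] by apply: filter_all.
rewrite -[[seq t <- q | predC _ t]]/[seq t <- q | ~~ empty t].
case: [seq t <- q | ~~ empty t] rqE => [|t [|t' q']]; case: (pmap id r) => [|v [|v' r']] //=.
  by move=> [->] /andP[/negbTE->].
by move=> [-> -> ->].
Qed.

Lemma strictly_dary_dary d T : (2 <= d)%N -> strictly_dary d T -> dary d T.
Proof.
move=> d2 /arity_address_strict sT.
by rewrite -[T]unlabel_address dary_unlabel // (arity_sub d2 (leqnn d)).
Qed.

Definition induces (D : rtree) (Y : eqType) (A : seq Y) (t : ltree Y) : bool :=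
  iso D (unlabel (restrict (fun x => x \in A) t)).

Lemma induced_address T (S : {set leaf T}) : S != finset.set0 ->
  Defs.induced S = Some (unlabel (restrict (fun a => a \in [seq val x | x in S]) (address T))).
Proof.
move=> S0; rewrite /Defs.induced; set P := (P in prune P).
have := suppress_prune P T; rewrite /=; case: emptyP => [E|_ <-]; last first.
  by case: (prune _ _) => //= u; rewrite suppress_mrca.
have /set0Pn[x xS] := S0; have /eqP := congr1 (@labels _) E.
rewrite labels_restrict labels_address => /eqP/(congr1 (fun r => val x \in r)).
by rewrite mem_filter (valP x) andbT /P /= map_f ?mem_enum.
Qed.

Lemma card_leaf T : #|{: leaf T}| = nleaves T.
Proof.
rewrite cardE -(size_map val) /nleaves; apply/perm_size/uniq_perm.
- by rewrite map_inj_uniq ?enum_uniq //; exact: val_inj.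
- exact: uniq_leaves.
move=> a; apply/mapP/idP => [[x _ ->]|aT]; first exact: valP.
by exists (SeqSub aT); rewrite ?mem_enum.
Qed.

Lemma copiesE D T : (0 < nleaves D)%N ->
  copies D T = #|[set S : {set leaf T} | (#|S| == nleaves D) &&
                   induces D [seq val x | x in S] (address T)]|.
Proof.
move=> D0; apply: eq_card => S; rewrite !inE; apply: andb_id2l => /eqP SD.
by rewrite induced_address // -card_gt0 SD.
Qed.

Lemma copies_ge D (Y : eqType) (I : finType) (L : {set I}) (e : I -> Y) u (t : ltree Y) :
  (0 < nleaves D)%N -> arity 2 u t -> injective e ->
  {in L, forall i, count_mem (e i) (labels t) = 1%N} ->
  (#|[set B : {set I} | [&& B \subset L, #|B| == nleaves D &
        induces D [seq e i | i in B] t]]| <= copies D (unlabel t))%N.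
Proof.
move=> D0 tP e_inj eL; rewrite copiesE //.
have [f tE] := address_unlabel tP; set T := unlabel t in tE *.
have labt : labels t = map f (leaves T) by rewrite tE labels_relabel labels_address.
have [x0 _] : exists x : leaf T, True.
  have := arity_labels tP; rewrite labt size_map => /(mem_nth [::]) aT.
  by exists (SeqSub aT).
have [phi phiP] : exists phi : I -> leaf T, {in L, forall i, f (val (phi i)) = e i}.
  have /choice[phi phiP] : forall i, exists x : leaf T, i \in L -> f (val x) = e i.
    move=> i; case: (boolP (i \in L)) => [iL|]; last by exists x0.
    have : e i \in labels t by rewrite -has_pred1 has_count eL.
    by rewrite labt => /mapP[a aT ->]; exists (SeqSub aT).
  by exists phi.
have fiberE a i : i \in L -> a \in leaves T -> f a = e i -> a = val (phi i).
  move=> iL aT fa; have := eL i iL; rewrite labt count_map -size_filter => sz.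
  have mem_fib b : b \in leaves T -> f b = e i ->
      b \in seq.filter (preim f (pred1 (e i))) (leaves T).
    by move=> bT fb; rewrite mem_filter /= fb eqxx.
  have := mem_fib _ aT fa; have := mem_fib _ (valP _) (phiP i iL).
  by case: seq.filter sz => [|b []] //= _; rewrite !inE => /eqP-> /eqP->.
have phi_inj : {in L &, injective phi}.
  by move=> i j iL jL E; apply: e_inj; rewrite -!phiP // E.
rewrite -(@card_in_imset _ _ (fun B : {set I} => [set phi i | i in B])).
  apply: subset_leq_card; apply/fintype.subsetP => _ /imsetP[B + ->].
  rewrite !inE => /and3P[/fintype.subsetP BL /eqP BD Be]; rewrite card_in_imset; last first.
    by move=> i j /BL iL /BL jL; apply: phi_inj.
  rewrite BD eqxx /=; move: Be; rewrite /induces {1}tE restrict_relabel unlabel_relabel.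
  congr (iso D (unlabel _)); apply: eq_in_restrict => a; rewrite labels_address => aT /=.
  apply/mapP/mapP => [[i]|[x]]; rewrite mem_enum => H E.
    exists (phi i); last by apply: fiberE => //; apply: BL.
    by rewrite mem_enum; apply: imset_f.
  move: H => /imsetP[i iB xE]; exists i; rewrite ?mem_enum // E xE phiP //.
  exact: BL.
move=> B B' + + E; rewrite !inE => /and3P[/fintype.subsetP BL _ _] /and3P[/fintype.subsetP BL' _ _].
wlog suff: B B' E BL BL' / B \subset B'.
  by move=> H; apply/eqP; rewrite finset.eqEsubset (H B B') // (H B' B).
apply/fintype.subsetP => i iB.
have : phi i \in [set phi i | i in B'] by rewrite -E imset_f.
by case/imsetP => j jB' /phi_inj -> //; [apply: BL | apply: BL'].
Qed.

Lemma delete_leaf D d T : (0 < nleaves D < nleaves T)%N -> dary d T ->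
  exists T', [/\ dary d T', nleaves T' = (nleaves T).-1 &
    ((nleaves T - nleaves D) * copies D T <= nleaves T * copies D T')%N].
Proof.
set k := nleaves D; set N := nleaves T => /andP[k0 kN] dT.
pose del (x : leaf T) := restrict (fun a => a != val x) (address T).
have labdel x : labels (del x) = [seq a <- leaves T | a != val x].
  by rewrite labels_restrict labels_address.
have szdel x : size (labels (del x)) = N.-1.
  rewrite labdel -rem_filter ?uniq_leaves // size_rem //; exact: valP.
have delP x : arity 2 d (del x).
  have := arity_restrict (fun a => a != val x) (arity_address dT).
  case: emptyP => // E; have := szdel x; rewrite /del E /=; lia.
pose C := [set S : {set leaf T} | (#|S| == k) && induces D [seq val x | x in S] (address T)].
have cC x : (#|[set B in C | x \notin B]| <= copies D (unlabel (del x)))%N.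
  have eL : {in [set~ x], forall y : leaf T, count_mem (val y) (labels (del x)) = 1%N}.
    move=> y; rewrite !inE => yx; rewrite labdel count_uniq_mem ?filter_uniq ?uniq_leaves //.
    by rewrite mem_filter (valP y) (inj_eq val_inj) yx.
  apply: leq_trans (copies_ge k0 (delP x) val_inj eL).
  apply: subset_leq_card; apply/fintype.subsetP => B; rewrite !inE => /andP[/andP[Bk BD] xB].
  rewrite Bk -finset.setCS finset.setCK finset.sub1set inE xB /=; move: BD.
  rewrite /induces restrict_restrict; congr (iso D (unlabel _)); apply: eq_in_restrict => a _ /=.
  case: (boolP (a \in _)) => //= /mapP[y]; rewrite mem_enum => yB ->.
  by rewrite (inj_eq val_inj); apply/esym; apply: contraNneq xB => <-.
have [x1 _] : exists x : leaf T, True.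
  have /(mem_nth [::]) aT : (0 < size (leaves T))%N by apply: leq_ltn_trans kN.
  by exists (SeqSub aT).
case: (@arg_maxnP _ x1 predT (fun x => copies D (unlabel (del x)))) => // x0 _ x0P.
exists (unlabel (del x0)); split; first exact: dary_unlabel.
  by rewrite (size_labels (delP x0)) szdel.
rewrite copiesE // -/C -[N in (_ <= N * _)%N]card_leaf -sum_nat_const.
apply: (@leq_trans (\sum_(x : leaf T) #|[set B in C | x \notin B]|)%N); last first.
  by apply: leq_sum => x _; apply: leq_trans (cC x) (x0P x isT).
rewrite (eq_bigr (fun x => \sum_(B in C) (x \notin B : nat))%N) => [|x _]; last first.
  rewrite -sum1_card (eq_bigl (fun B => (B \in C) && (x \notin B))) => [|B]; last first.
    by rewrite finset.in_set.
  by rewrite big_mkcondr; apply: eq_bigr => B _; case: (x \in B).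
rewrite exchange_big /= mulnC -sum_nat_const; apply: leq_sum => B; rewrite inE => /andP[/eqP Bk _].
rewrite (eq_bigr (fun x => if x \in ~: B then 1 else 0)%N) => [|x _]; last first.
  by rewrite inE; case: (x \in B).
by rewrite -big_mkcond sum1_card -[N]card_leaf -Bk [#|~: B|]cardsCs finset.setCK.
Qed.

Fixpoint complete (d : nat) (Y : Type) (t : ltree Y) : ltree (option Y) :=
  match t with
  | Lf x => Lf (Some x)
  | Nd s => Nd (map (@complete d Y) s ++ nseq (d - size s) (Lf None))
  end.

Lemma arity_complete d Y (t : ltree Y) : arity 2 d t -> arity d d (complete d t).
Proof.
elim/ltree_ind': t => [x|s IHs] //= /andP[/andP[_ sd] /allP sP].
rewrite size_cat size_map size_nseq subnKC // leqnn all_cat.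
apply/andP; split=> //; apply/andP; split.
  by rewrite all_map; apply/allP => t ts; apply: IHs => //; apply: sP.
by rewrite all_nseq orbT.
Qed.

Lemma size_labels_complete d Y (t : ltree Y) : arity 2 d t ->
  (size (labels (complete d t)) + d <= size (labels t) * d.+1)%N.
Proof.
elim/ltree_ind': t => [x|s IHs] /=; first lia.
move=> /andP[/andP[s2 sd] sP].
rewrite map_cat flatten_cat size_cat map_nseq /= -map_comp.
have -> : size (flatten (nseq (d - size s) [:: @None Y])) = (d - size s)%N.
  by elim: (d - size s)%N => //= n ->.
have : (size (flatten [seq labels (complete d t) | t <- s]) + size s * d <=
   size (flatten (map (@labels Y) s)) * d.+1)%N.
  elim: s IHs sP {s2 sd} => //= t s IHs' IHs /andP[tP sP].
  have := IHs t (mem_head _ _) tP.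
  have := IHs' (fun u us => IHs u (mem_behead (s := t :: s) us)) sP.
  rewrite !size_cat; lia.
have : (2 * d <= size s * d)%N by rewrite leq_mul2r s2 orbT.
move: (size s * d)%N (_ * d.+1)%N => a b; rewrite /comp. lia.
Qed.

Lemma pmap_labels_complete d Y (t : ltree Y) : pmap id (labels (complete d t)) = labels t.
Proof.
elim/ltree_ind': t => [x|s IHs] //=.
rewrite map_cat flatten_cat pmap_cat -map_comp map_nseq /=.
have -> : pmap id (flatten (nseq (d - size s) [:: @None Y])) = [::].
  by elim: (d - size s)%N => //= n ->.
rewrite cats0; elim: s IHs => //= t s IHs' IHs.
rewrite pmap_cat IHs ?mem_head // IHs' // => u us.
by apply: IHs; rewrite in_cons us orbT.
Qed.

Lemma restrict_complete d (Y : eqType) (P : pred (option Y)) (t : ltree Y) : arity 2 d t ->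
  P None = false -> restrict P (complete d t) = relabel Some (restrict (P \o Some) t).
Proof.
move=> + PN; elim/ltree_ind': t => [x|s IHs] /=; first by case: (P _).
move=> /andP[_ /allP sP].
rewrite map_cat filter_cat map_nseq /= PN [X in _ ++ X](_ : _ = [::]); last first.
  by elim: (d - size s)%N.
have emptyE t : empty (relabel (@Some Y) t) = empty t by case: t => [|[]].
rewrite cats0 -map_comp [map (_ \o _) s](_ : _ = map (relabel Some) (map (restrict (P \o Some)) s)); last first.
  by rewrite -map_comp; apply/eq_in_map => t ts /=; rewrite IHs //; apply: sP.
rewrite filter_map (eq_filter (a2 := predC (@empty Y))) => [|t /=]; last by rewrite emptyE.
by case: (seq.filter _ _) => [|t []].
Qed.


Lemma size_labels_mod d Y (t : ltree Y) : (2 <= d)%N -> arity d d t ->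
  size (labels t) = 1 %[mod d.-1].
Proof.
move=> d2; elim/ltree_ind': t => [x|s IHs] //= /andP[/andP[ds sd] sP].
have sE : size s = d by apply/eqP; rewrite eqn_leq sd ds.
transitivity (size s %% d.-1)%N; last by rewrite sE -{1}(prednK (ltnW d2)) -addn1 modnDl.
elim: s IHs sP {ds sd sE} => //= t s IHs' IHs /andP[tP sP].
rewrite size_cat -modnDm IHs ?mem_head // IHs' ?modnDm ?add1n // => u us.
by apply: IHs; rewrite in_cons us orbT.
Qed.

Lemma restrict_label1 Y u (P : pred Y) (t : ltree Y) y : arity 2 u t ->
  seq.filter P (labels t) = [:: y] -> restrict P t = Lf y.
Proof.
move=> tP; rewrite -labels_restrict => E; apply: (@arity_labels1 _ u _ _ _ E).
by have := arity_restrict P tP; case: emptyP E => // ->.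
Qed.

Lemma restrict_label0 Y u (P : pred Y) (t : ltree Y) : arity 2 u t ->
  seq.filter P (labels t) = [::] -> restrict P t = Nd [::].
Proof.
move=> tP; rewrite -labels_restrict => E.
by have := arity_restrict P tP; case: emptyP => //= _ /arity_labels; rewrite E.
Qed.

Lemma blowup D d S m n : (2 <= d)%N -> (0 < nleaves D)%N -> dary d S -> (0 < m)%N ->
  m = 1 %[mod d.-1] -> n = 1 %[mod d.-1] -> (nleaves S * (m + d) <= n)%N ->
  exists T, [/\ strictly_dary d T, nleaves T = n &
                (copies D S * m ^ nleaves D <= copies D T)%N].
Proof.
move=> d2 k0 dS; case: m => // m' _; set m := m'.+1 => mM nM le_n.
set s := nleaves S in le_n *.
have aS := arity_address dS.
have s0 : (0 < s)%N by rewrite /s /nleaves -labels_address; apply: arity_labels aS.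
pose t0 := complete d (address S); set E := size (labels t0).
have aT0 : arity d d t0 by apply: arity_complete.
have labt0 : pmap id (labels t0) = leaves S.
  by rewrite pmap_labels_complete labels_address.
have leE : (E + d <= s * d.+1)%N.
  by have := size_labels_complete aS; rewrite labels_address.
have sE : (s <= E)%N by rewrite /s /nleaves -labt0 size_pmap count_size.
have EM : E = 1 %[mod d.-1] by apply: size_labels_mod.
pose r := (n - (E - s) - s.-1 * m)%N.
have smE : (s * m = s.-1 * m + m)%N by rewrite -{1}(prednK s0) mulSnr.
move: le_n leE; rewrite mulnDr smE mulnS => le_n leE.
have [rm rE] : (m <= r)%N /\ (n + s = r + s.-1 * m + E)%N.
  rewrite /r; move: le_n leE sE; move: (s.-1 * m)%N (s * d)%N => p q; clearbody s E m.
  by clear; lia.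
have pM : (s.-1 * m + E = s %[mod d.-1])%N.
  by rewrite -modnDml -modnMmr mM modnMmr muln1 modnDml -modnDmr EM modnDmr addn1 prednK.
have rM : r = 1 %[mod d.-1].
  apply/eqP; rewrite -(eqn_modDr (s.-1 * m + E)) addnA -rE.
  by rewrite -modnDml nM modnDml -[in eqbRHS]modnDmr pM modnDmr.
have [T1 [sT1 nT1]] : exists T, strictly_dary d T /\ nleaves T = m.
  exact: strict_tree_exists.
have [T2 [sT2 nT2]] : exists T, strictly_dary d T /\ nleaves T = r.
  by apply: strict_tree_exists => //; apply: leq_trans rm.
pose a0 := nth [::] (leaves S) 0; have a0S : a0 \in leaves S by apply: mem_nth.
pose blob (a : seq nat) := if a == a0 then T2 else T1.
have blobP a : arity d d (address (blob a)).
  by apply: arity_address_strict; rewrite /blob; case: ifP.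
have nblob a : nleaves (blob a) = if a == a0 then r else m.
  by rewrite /blob; case: ifP.
have blobm a : (m <= nleaves (blob a))%N by rewrite nblob; case: ifP.
pose b (o : option (seq nat)) : ltree (option (seq nat * seq nat)) :=
  if o is Some a then relabel (fun c => Some (a, c)) (address (blob a)) else Lf None.
have aB o : arity d d (b o) by case: o => //= a; apply: arity_bind.
pose t := bind b t0.
have aT : arity d d t by apply: arity_bind.
have aT2 : arity 2 d t by apply: arity_sub aT.
have labb a : labels (b (Some a)) = [seq Some (a, c) | c <- leaves (blob a)].
  by rewrite labels_relabel labels_address.
have sizet : size (labels t) = n.
  rewrite labels_bind size_flatten /shape -map_comp sumnE big_map.
  apply/(@addIn s); rewrite rE -[s in LHS]sum1_size -labt0 big_pmap -big_split /=.
  rewrite (eq_bigr (fun o => (oapp (fun a => nleaves (blob a)) 0 o + 1)%N)); last first.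
    by case=> [a|] _ //=; rewrite labb size_map.
  rewrite big_split /= sum1_size -/E -(big_pmap id) labt0.
  congr (_ + _)%N; rewrite (bigD1_seq a0) ?uniq_leaves //= nblob eqxx; congr (_ + _)%N.
  rewrite (eq_bigr (fun=> m)) => [|a /negbTE aa0]; last by rewrite nblob aa0.
  rewrite big_const_seq iter_addn_0 mulnC; congr (_ * _)%N.
  by rewrite /s /nleaves -(count_predC (pred1 a0)) count_uniq_mem ?uniq_leaves // a0S.
pose c0 (x : leaf S) (j : 'I_m) := nth [::] (leaves (blob (val x))) j.
have c0P x j : c0 x j \in leaves (blob (val x)).
  by apply: mem_nth; apply: leq_trans (blobm _).
pose e (i : leaf S * 'I_m) := Some (val i.1, c0 i.1 i.2).
have e_inj : injective e.
  move=> [x j] [y l] [] /val_inj <- /eqP; rewrite nth_uniq ?uniq_leaves //;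
    try exact: leq_trans (blobm _).
  by move=> /eqP/val_inj->.
have eT : {in [set: leaf S * 'I_m], forall i, count_mem (e i) (labels t) = 1%N}.
  move=> [x j] _; rewrite labels_bind count_flatten -map_comp sumnE big_map.
  rewrite (eq_bigr (fun o => oapp (fun a => (a == val x : nat)) 0%N o)) => [|[a|] _] //=; last first.
    rewrite labb count_map; case: (eqVneq a (val x)) => [->|ax].
      rewrite (eq_count (a2 := pred1 (c0 x j))) => [|c].
        by rewrite count_uniq_mem ?uniq_leaves // c0P.
      by apply/eqP/eqP => [[]|->].
    rewrite (eq_count (a2 := pred0)) ?count_pred0 // => c /=.
    by apply/eqP => -[ax']; rewrite ax' eqxx in ax.
  rewrite -(big_pmap id) labt0 (bigD1_seq (val x)) ?uniq_leaves ?(valP x) //= eqxx.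
  by rewrite big1 // => a /negbTE->.
pose C := [set B : {set leaf S} | (#|B| == nleaves D) && induces D [seq val x | x in B] (address S)].
pose graph (p : {set leaf S} * {ffun leaf S -> 'I_m}) := [set (x, p.2 x) | x in p.1].
have graphE B (g : {ffun leaf S -> 'I_m}) :
    induces D [seq e i | i in graph (B, g)] t = induces D [seq val x | x in B] (address S).
  pose P o := o \in [seq e i | i in graph (B, g)].
  have PE (x : leaf S) c : P (Some (val x, c)) = (x \in B) && (c == c0 x (g x)).
    apply/mapP/andP => [[[y j]]|[xB /eqP->]].
      rewrite mem_enum => /imsetP[z zB [-> ->]] [] /val_inj-> ->.
      by split.
    by exists (x, g x) => //; rewrite mem_enum; apply: imset_f.
  pose Q o := o \in [seq Some (val x) | x in B].
  have QE (x : leaf S) : Q (Some (val x)) = (x \in B).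
    apply/mapP/idP => [[y]|xB]; rewrite ?mem_enum; first by move=> yB [/val_inj->].
    by exists x; rewrite ?mem_enum.
  have QN : Q None = false by apply/negbTE/mapP => -[].
  pose G o := if o is Some a then
    Some (a, oapp (fun x => c0 x (g x)) [::] (insub a)) else None.
  rewrite /induces /t -/P (restrict_bind (g := G) (Q := Q)) => [|[a|] aT0']; last first.
  - by rewrite QN /= (_ : P None = false) //; apply/negbTE/mapP => -[].
  - have aS' : a \in leaves S by rewrite -labt0 mem_pmap map_id.
    pose x : leaf S := SeqSub aS'; rewrite -[a]/(val x) QE.
    have ab := arity_sub d2 (leqnn d) (aB (Some (val x))).
    have labP : seq.filter P (labels (b (Some (val x)))) =
        if x \in B then [:: Some (val x, c0 x (g x))] else [::].
      rewrite labb filter_map; case: ifP => xB.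
        rewrite (eq_filter (a2 := pred1 (c0 x (g x)))) => [|c].
          2: by rewrite -[LHS]/(P (Some (val x, c))) PE xB.
        by rewrite filter_pred1_uniq ?uniq_leaves.
      rewrite (eq_filter (a2 := pred0)) ?filter_pred0 // => c.
      by rewrite -[LHS]/(P (Some (val x, c))) PE xB.
    move: labP; rewrite /G valK /=; case: (x \in B).
      exact: restrict_label1 ab.
    exact: restrict_label0 ab.
  rewrite unlabel_relabel restrict_complete // unlabel_relabel.
  congr (iso D (unlabel _)); apply: eq_in_restrict => a; rewrite labels_address => aS' /=.
  rewrite -[a]/(val (SeqSub aS' : leaf S)) QE; apply/idP/mapP => [xB|[y]].
    by exists (SeqSub aS'); rewrite ?mem_enum.
  by rewrite mem_enum => + /val_inj->.
exists (unlabel t); split; first exact: strictly_dary_unlabel.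
  by rewrite (size_labels aT2).
apply: leq_trans (copies_ge k0 aT2 e_inj eT).
pose F := [set p : {set leaf S} * {ffun leaf S -> 'I_m} |
  (p.1 \in C) && (p.2 \in pffun_on ord0 [in p.1] predT)].
have -> : (copies D S * m ^ nleaves D = #|F|)%N.
  rewrite copiesE // -/C -sum_nat_const -[RHS]sum1_card.
  rewrite (eq_bigl (fun p => (p.1 \in C) && (p.2 \in pffun_on ord0 [in p.1] predT))); last first.
    by move=> p; rewrite finset.in_set.
  rewrite -(pair_big_dep (fun B => B \in C) (fun B g => g \in pffun_on ord0 [in B] predT)
    (fun _ _ => 1%N)) /=.
  apply: eq_bigr => B; rewrite inE => /andP[/eqP <- _].
  by rewrite sum1_card card_pffun_on card_ord.
rewrite -(@card_in_imset _ _ graph).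
  apply: subset_leq_card; apply/fintype.subsetP => _ /imsetP[[B g] + ->].
  rewrite !inE /= => /andP[/andP[/eqP Bk BD] _].
  rewrite finset.subsetT graphE BD card_in_imset ?Bk ?eqxx // => x y _ _ [].
  done.
move=> [B g] [B' g']; rewrite !inE /= => /andP[_ /pffun_onP[gB _]] /andP[_ /pffun_onP[gB' _]] E'.
have BE : B = B'.
  have fstE A (h : {ffun leaf S -> 'I_m}) : [set i.1 | i in graph (A, h)] = A.
    rewrite /graph -imset_comp /=; exact: imset_id.
  by rewrite -[LHS](fstE B g) E' fstE.
rewrite -BE in gB' E' *; congr (_, _); apply/ffunP => x.
have [xB|xB] := boolP (x \in B).
  have : (x, g x) \in graph (B, g') by rewrite -E'; apply: imset_f.
  by case/imsetP => y _ [-> ->].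
have out (h : {ffun leaf S -> 'I_m}) : {subset finfun.support_for ord0 h <= [in B]} -> h x = ord0.
  by move=> hB; apply/eqP; apply: contraNT xB => hx; apply: hB.
by rewrite !out //; apply/fintype.subsetP.
Qed.

Local Open Scope ring_scope.

Lemma density_ge0 (R : realType) D T : 0 <= density R D T.
Proof. by rewrite divr_ge0. Qed.

Lemma density_le1 (R : realType) D T : density R D T <= 1.
Proof.
have le_bin : (copies D T <= 'C(nleaves T, nleaves D))%N.
  rewrite -card_leaf -card_draws; apply: subset_leq_card; apply/fintype.subsetP => S.
  by rewrite !inE => /andP[].
rewrite /density; have [->|C0] := posnP 'C(nleaves T, nleaves D).
  by rewrite invr0 mulr0.
by rewrite ler_pdivrMr ?ltr0n // mul1r ler_nat.
Qed.

Lemma exists_denser_subtree (R : realType) D d T s : (0 < nleaves D <= s)%N ->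
  (s <= nleaves T)%N -> dary d T ->
  exists S, [/\ dary d S, nleaves S = s & density R D T <= density R D S].
Proof.
move=> /andP[k0 ks]; move: {2}(nleaves T - s)%N (erefl (nleaves T - s)%N) => r.
elim: r T => [|r IHr] T rE sT dT.
  by exists T; split=> //; apply/eqP; rewrite eqn_leq sT -subn_eq0 rE.
have kT : (0 < nleaves D < nleaves T)%N by rewrite k0 /=; lia.
have [T' [dT' nT' cT']] := delete_leaf kT dT.
have [||//|S [dS nS TS]] := IHr T'; try by rewrite nT'; lia.
exists S; split=> //; apply: le_trans TS.
rewrite /density nT' ler_pdivrMr ?ltr0n ?bin_gt0; last lia.
rewrite mulrAC ler_pdivlMr ?ltr0n ?bin_gt0; last lia.
rewrite -!natrM ler_nat -(@leq_pmul2l (nleaves T)); last lia.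
by rewrite mulnCA mul_bin_down mulnCA !mulnA leq_mul2r cT' orbT.
Qed.

Lemma Bernoulli (R : realType) (x : R) k : 0 <= x <= 1 -> 1 - k%:R * x <= (1 - x) ^+ k.
Proof.
move=> /andP[x0 x1]; elim: k => [|k IHk]; first by rewrite mul0r subr0 expr0.
rewrite exprS; apply: (@le_trans _ _ ((1 - x) * (1 - k%:R * x))); last first.
  by rewrite ler_wpM2l // subr_ge0.
have : 0 <= k%:R * x ^+ 2 by rewrite mulr_ge0 ?exprn_ge0.
rewrite -natr1; lra.
Qed.

Lemma leq_exp_ffact s k : ((s - k) ^ k <= s ^_ k)%N.
Proof.
rewrite ffact_prod -[k in (_ ^ k)%N]card_ord -prod_nat_const.
by apply: leq_prod => i _; rewrite leq_sub2l // ltnW.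
Qed.

Lemma ffact_leq_exp s k : (s ^_ k <= s ^ k)%N.
Proof.
by elim: k => // k IHk; rewrite ffactnSr expnSr leq_mul // leq_subr.
Qed.

Lemma bin_ratio_ge (R : realType) (s m n k : nat) : (k <= s)%N -> (0 < m)%N -> (s * m <= n)%N ->
  1 - k%:R * (1 - (s * m)%:R / n%:R + k%:R / s%:R) <=
  ('C(s, k) * m ^ k)%:R / 'C(n, k)%:R :> R.
Proof.
move=> ks m0 smn.
have [->|k0] := posnP k; first by rewrite !bin0 expn0 mul0r subr0 divr1.
have s0 : (0 < s)%N by apply: leq_trans ks.
have n0 : (0 < n)%N by apply: leq_trans smn; rewrite muln_gt0 s0.
have kn : (k <= n)%N by apply: leq_trans smn; apply: leq_trans ks _; rewrite leq_pmulr.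
have n0R : 0 < n%:R :> R by rewrite ltr0n.
have s0R : 0 < s%:R :> R by rewrite ltr0n.
set y : R := ((s - k) * m)%:R / n%:R.
have y01 : 0 <= 1 - y <= 1.
  rewrite subr_ge0 gerBl divr_ge0 // andbT ler_pdivrMr // mul1r ler_nat.
  by apply: leq_trans smn; rewrite leq_mul2r leq_subr orbT.
apply: (@le_trans _ _ (1 - k%:R * (1 - y))).
  rewrite lerB // ler_wpM2l //.
  suff : (s * m)%:R / n%:R - k%:R / s%:R <= y by lra.
  rewrite /y mulnBl natrB ?leq_mul2r ?ks ?orbT // mulrBl lerD2l lerN2.
  rewrite ler_pdivrMr // mulrAC ler_pdivlMr // -!natrM ler_nat -mulnA leq_mul2l.
  by rewrite [(m * s)%N]mulnC smn orbT.
apply: le_trans (Bernoulli k y01) _; rewrite subKr.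
rewrite -(@ler_pM2r _ ('C(n, k) * k`!)%:R) ?ltr0n ?muln_gt0 ?bin_gt0 ?kn ?fact_gt0 //.
have -> : ('C(s, k) * m ^ k)%:R / 'C(n, k)%:R * ('C(n, k) * k`!)%:R = (s ^_ k * m ^ k)%:R :> R.
  rewrite natrM [X in _ * X]natrM mulrA divfK ?pnatr_eq0 -?lt0n ?bin_gt0 //.
  by rewrite -!natrM mulnAC bin_ffact.
rewrite bin_ffact expr_div_n mulrAC ler_pdivrMr ?exprn_gt0 //.
rewrite -!natrX -!natrM ler_nat; apply: leq_mul; last exact: ffact_leq_exp.
by rewrite expnMn leq_mul2r leq_exp_ffact orbT.
Qed.

Lemma exists_blob_size d s n : (2 <= d)%N -> (0 < s)%N -> (s * d.+1 <= n)%N ->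
  exists m, [/\ (0 < m)%N, m = 1 %[mod d.-1], (s * (m + d) <= n)%N &
                 (n <= s * m + 3 * d * s)%N].
Proof.
move=> d2 s0 sn; pose q := (n %/ s)%N.
have qd : (d.+1 <= q)%N by rewrite leq_divRL // mulnC.
pose r := ((q - d.+1) %/ d.-1)%N.
have d1 : (0 < d.-1)%N by rewrite -ltnS prednK // ltnW.
have rle : (r * d.-1 <= q - d.+1)%N by apply: leq_trunc_div.
have rge : (q - d.+1 < r * d.-1 + d.-1)%N by rewrite -mulSnr ltn_ceil.
have qle : (q * s <= n)%N by apply: leq_trunc_div.
have qge : (n < q * s + s)%N by rewrite -mulSnr ltn_ceil.
exists (r * d.-1 + 1)%N; split; rewrite ?addn1 //.
- by rewrite -addn1 modnMDl.
- apply: leq_trans qle; rewrite mulnC leq_mul2r; apply/orP; right.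
  by clearbody r q; move: rle; clear -qd; move: (r * _)%N => a; lia.
apply: (leq_trans (ltnW qge)); rewrite -mulSnr [X in (_ <= X + _)%N]mulnC -mulnDl leq_mul2r.
apply/orP; right; clearbody r q; move: rge; clear -qd d2; move: (r * _)%N => a; lia.
Qed.

Lemma limn_sup_ge (R : realType) (u : R^nat) a : bounded_fun u ->
  (forall J, exists2 j, (J <= j)%N & a <= u j) -> a <= limn_sup u.
Proof.
move=> bu au; rewrite limn_supE //; apply: lb_le_inf; first by exists (sups u 0); exists 0%N.
move=> _ [J _ <-]; have [j Jj] := au J; move/le_trans; apply.
apply: ub_le_sup; last by exists j.
have [M Mu] := bounded_fun_has_ubound bu.
by exists M => _ [i _ <-]; apply: Mu; exists i.
Qed.

Lemma limn_sup_le (R : realType) (u : R^nat) a J : bounded_fun u ->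
  (forall j, (J <= j)%N -> u j <= a) -> limn_sup u <= a.
Proof.
move=> bu ua; rewrite limn_supE //; apply: (@le_trans _ _ (sups u J)).
  apply: ge_inf; last by exists J.
  by have [M Mu] := bounded_fun_has_lbound_sups bu; exists M.
apply: ge_sup => [|_ [j Jj <-]]; last exact: ua.
by exists (u J); exists J => /=.
Qed.

Lemma max_density_itv (R : realType) d D n : (2 <= d)%N -> (0 < n)%N ->
  n = 1 %[mod d.-1] -> 0 <= max_density R d D n <= 1.
Proof.
move=> d2 n0 nM; have [[T [_ _ <-]] _] := max_densityP R D (strict_tree_exists d2 n0 nM).
by rewrite density_ge0 density_le1.
Qed.

Lemma max_density_ge (R : realType) d D S n : (2 <= d)%N -> (0 < nleaves D)%N ->
  dary d S -> (0 < n)%N -> n = 1 %[mod d.-1] ->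
  density R D S - (nleaves D)%:R * ((nleaves D)%:R / (nleaves S)%:R +
      (3 * d * nleaves S)%:R / n%:R) <= max_density R d D n.
Proof.
set k := nleaves D; set s := nleaves S; move=> d2 k0 dS n0 nM.
have n0R : 0 < n%:R :> R by rewrite ltr0n.
have /andP[f0 f1] := max_density_itv R D d2 n0 nM.
set z := _ * _; have z0 : 0 <= z by rewrite mulr_ge0 // addr_ge0 // divr_ge0.
have [sk|ks] := ltnP s k.
  by apply: le_trans f0; rewrite /density bin_small // invr0 mulr0 sub0r oppr_le0.
have s0 : (0 < s)%N by apply: leq_trans ks.
have k1R : 1 <= k%:R :> R by rewrite ler1n.
have ks0 : 0 <= k%:R / s%:R :> R by rewrite divr_ge0.
have [sn|ns] := leqP (s * d.+1) n; last first.
  apply: le_trans f0; rewrite subr_le0; apply: le_trans (density_le1 R D S) _.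
  apply: le_trans (_ : 1 <= (3 * d * s)%:R / n%:R) _.
    by rewrite ler_pdivlMr // mul1r ler_nat; nia.
  have : 0 <= (3 * d * s)%:R / n%:R :> R by rewrite divr_ge0.
  by rewrite /z; nra.
have [m [m0 mM smn nsm]] := exists_blob_size d2 s0 sn.
have [T [sT nT cT]] := blowup d2 k0 dS m0 mM nM smn.
have [_ /(_ T sT nT)] := max_densityP R D (strict_tree_exists d2 n0 nM).
apply: le_trans.
have smn' : (s * m <= n)%N.
  by apply: leq_trans smn; rewrite leq_mul2l leq_addr orbT.
have ratio := bin_ratio_ge R ks m0 smn'.
have zle : 1 - z <= ('C(s, k) * m ^ k)%:R / 'C(n, k)%:R.
  apply: le_trans ratio; rewrite lerB // ler_wpM2l // addrC lerD2l.
  by rewrite lerBlDr -mulrDl ler_pdivlMr // mul1r -natrD ler_nat addnC.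
apply: (@le_trans _ _ (density R D S * (('C(s, k) * m ^ k)%:R / 'C(n, k)%:R))).
  have q0 := density_ge0 R D S; have q1 := density_le1 R D S.
  by apply: le_trans (ler_wpM2l q0 zle); nra.
rewrite /density nT -/s -/k mulrA ler_wpM2r ?invr_ge0 // natrM mulrA.
rewrite divfK ?pnatr_eq0 -?lt0n ?bin_gt0 //.
by rewrite -natrM ler_nat.
Qed.

Lemma bounded_max_density (R : realType) d D : (2 <= d)%N ->
  bounded_fun (fun j => max_density R d D (j * d.-1 + 1)).
Proof.
move=> d2; exists 1; split=> // M M1 j _ /=.
have /andP[f0 f1] : 0 <= max_density R d D (j * d.-1 + 1) <= 1.
  by apply: max_density_itv; rewrite ?addn1 // -addn1 modnMDl.
by rewrite ger0_norm // (le_trans f1) // ltW.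
Qed.

Lemma max_density_le_inducibility (R : realType) d D n : (2 <= d)%N -> (0 < nleaves D)%N ->
  (0 < n)%N -> n = 1 %[mod d.-1] ->
  max_density R d D n <= inducibility R d D +
    (nleaves D)%:R * ((nleaves D)%:R + (3 * d)%:R) / n%:R.
Proof.
move=> d2 k0 n0 nM.
have [[T [sT nT <-]] _] := max_densityP R D (strict_tree_exists d2 n0 nM).
rewrite -lerBlDr; apply: limn_sup_ge => [|J]; first exact: bounded_max_density.
exists (J + n ^ 2)%N; first exact: leq_addr.
set N := (_ * _ + 1)%N; have N0 : (0 < N)%N by rewrite /N addn1.
have nN : (n * n <= N)%N.
  rewrite /N -mulnn; apply: leq_trans (leq_addr _ _).
  have d1 : (0 < d.-1)%N by rewrite -ltnS prednK // ltnW.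
  by apply: leq_trans (leq_pmulr _ d1); apply: leq_addl.
have NM : N = 1 %[mod d.-1] by rewrite /N modnMDl.
have dT : dary d T by exact: strictly_dary_dary.
apply: le_trans (max_density_ge R d2 k0 dT N0 NM).
rewrite nT lerB // -mulrA ler_wpM2l // mulrDl lerD2l.
rewrite ler_pdivrMr ?ltr0n // mulrAC ler_pdivlMr ?ltr0n // -!natrM ler_nat.
by rewrite -mulnA leq_mul2l nN orbT.
Qed.

Lemma inducibility_le_max_density (R : realType) d D n s : (2 <= d)%N -> (0 < nleaves D)%N ->
  (0 < s)%N -> (0 < n)%N -> n = 1 %[mod d.-1] ->
  inducibility R d D <= max_density R d D n + 
    (nleaves D)%:R * ((nleaves D)%:R / s%:R + (3 * d * s)%:R / n%:R).
Proof.
move=> d2 k0 s0 n0 nM; apply: (@limn_sup_le _ _ _ s); first exact: bounded_max_density.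
move=> j sj; set N := (_ * _ + 1)%N; have N0 : (0 < N)%N by rewrite /N addn1.
have NM : N = 1 %[mod d.-1] by rewrite /N modnMDl.
have /andP[f0 f1] := max_density_itv R D d2 n0 nM.
have [sk|ks] := ltnP s (nleaves D).
  have /andP[_ fN1] := max_density_itv R D d2 N0 NM; apply: le_trans fN1 _.
  rewrite mulrDr; apply: ler_wpDl => //; apply: ler_wpDr.
    by rewrite mulr_ge0 // divr_ge0.
  rewrite mulrA ler_pdivlMr ?ltr0n // mul1r -natrM ler_nat; nia.
have [[T [sT nT <-]] _] := max_densityP R D (strict_tree_exists d2 N0 NM).
have dT : dary d T by exact: strictly_dary_dary.
have sN : (s <= nleaves T)%N.
  have d1 : (0 < d.-1)%N by rewrite -ltnS prednK // ltnW.
  rewrite nT; apply: leq_trans sj _; apply: leq_trans (leq_addr _ _).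
  exact: leq_pmulr.
have ksk : (0 < nleaves D <= s)%N by rewrite k0.
have [S [dS nS TS]] := exists_denser_subtree R ksk sN dT.
apply: le_trans TS _; rewrite -lerBlDr -nS; exact: max_density_ge.
Qed.

Lemma nat_sqrt n : exists s, (s ^ 2 <= n < s.+1 ^ 2)%N.
Proof.
elim: n => [|n [s /andP[sn ns]]]; first by exists 0%N.
have [ns'|sn'] := ltnP n.+1 (s.+1 ^ 2); first by exists s; rewrite ns' (leq_trans sn).
by exists s.+1; rewrite sn' (leq_ltn_trans ns) // ltn_exp2r.
Qed.

Local Open Scope classical_set_scope.
Local Open Scope ring_scope.

Theorem corollary6 (R : realType) (d : nat) (D : rtree) (d_ge2 : (2 <= d)%N)
    (D_dary : dary d D) (D_ge2 : (2 <= nleaves D)%N) :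
  (exists K : R, forall n : nat,
     (nleaves D <= n)%N -> n = 1 %[mod d.-1] ->
     `|max_density R d D n - inducibility R d D| <= K / Num.sqrt n%:R) /\
  max_density R d D n @[n --> within [set n | n = 1 %[mod d.-1]] \oo] -->
    inducibility R d D.
Proof.
have k0 : (0 < nleaves D)%N by apply: ltnW.
pose k : R := (nleaves D)%:R; pose c : R := (3 * d)%:R; pose K := k * (2 * k + c).
have bound n : (nleaves D <= n)%N -> n = 1 %[mod d.-1] ->
    `|max_density R d D n - inducibility R d D| <= K / Num.sqrt n%:R.
  move=> kn nM; have n0 : (0 < n)%N by apply: leq_trans kn.
  have [s /andP[sn ns]] := nat_sqrt n.
  have s0 : (0 < s)%N by case: s ns sn => // + _; rewrite ltnS leqNgt n0.
  have := max_density_le_inducibility R d_ge2 k0 n0 nM.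
  have := inducibility_le_max_density R d_ge2 k0 s0 n0 nM.
  rewrite -/k natrM -/c => lo up.
  set r := Num.sqrt (n%:R : R).
  have r2 : r ^+ 2 = n%:R by rewrite sqr_sqrtr.
  have r1 : 1 <= r by rewrite -sqrtr1 ler_sqrt // ler1n.
  have sr : s%:R <= r by rewrite -(@ler_pXn2r _ 2) ?nnegrE ?sqrtr_ge0 // r2 -natrX ler_nat.
  have rs : r <= 2 * s%:R.
    rewrite -(@ler_pXn2r _ 2) ?nnegrE ?mulr_ge0 ?sqrtr_ge0 // r2 exprMn -!natrX -natrM ler_nat.
    by apply: leq_trans (ltnW ns) _; rewrite -expnMn leq_exp2r //; lia.
  have r0 : 0 < r by apply: lt_le_trans r1.
  have s0R : 0 < s%:R :> R by rewrite ltr0n.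
  have inv_s : s%:R^-1 <= 2 / r by rewrite ler_pdivlMr // ler_pdivrMl // mulrC.
  have s_n : s%:R / n%:R <= r^-1.
    rewrite -r2 expr2 invfM mulrA ler_pdivrMr // mulVf ?gt_eqF //.
    by rewrite ler_pdivrMr ?mul1r.
  have inv_n : n%:R^-1 <= r^-1 by rewrite -r2 lef_pV2 ?posrE ?exprn_gt0 // expr2 ler_pMl.
  have kge0 : 0 <= k by []. have cge0 : 0 <= c by [].
  have ri0 : 0 <= r^-1 by rewrite invr_ge0 ltW.
  have e1 : k * (k + c) / n%:R <= K / r.
    apply: (@le_trans _ _ (k * (k + c) / r)); rewrite ?ler_wpM2l ?mulr_ge0 ?addr_ge0 //.
    by rewrite ler_wpM2r // /K ler_wpM2l // lerD2r; lra.
  have e2 : k * (k / s%:R + c * s%:R / n%:R) <= K / r.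
    rewrite /K -[leRHS]mulrA ler_wpM2l // [leRHS]mulrDl [2 * k]mulrC -mulrA lerD // ?ler_wpM2l //.
    by rewrite -mulrA ler_wpM2l.
  by rewrite ler_norml; apply/andP; split; lra.
split; first by exists K.
apply/cvgrPdist_le => e e0; rewrite near_withinE; near=> n => /= nM.
have kn : (nleaves D <= n)%N by near: n; exact: nbhs_infty_ge.
rewrite distrC; apply: le_trans (bound n kn nM) _.
have n0R : 0 < n%:R :> R by rewrite ltr0n (leq_trans k0).
rewrite ler_pdivrMr ?sqrtr_gt0 // mulrC -ler_pdivrMr //.
apply: le_trans (ler_norm _) _; rewrite -sqrtr_sqr ler_sqrt //.
near: n; exact: nbhs_infty_ger.
Unshelve. all: by end_near.
Qed.
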